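(* Let $n\ge 4$ and let $S\in\{\mathcal{CP}_n,\mathcal{ORCP}_n,\mathcal{OCP}_n\}$. Then $S$ is not right abundant.
   Context: Let $[n]=\{1,2,\dots,n\}$ with the usual order, and let $\mathcal{P}_n$ be the semigroup of all partial maps $\alpha$ with domain $\operatorname{Dom}\alpha\subseteq[n]$ and image $\operatorname{Im}\alpha\subseteq[n]$ (including the empty map). Maps are written on the right and composed left to right: $x(\alpha\beta)=(x\alpha)\beta$, defined for those $x\in\operatorname{Dom}\alpha$ with $x\alpha\in\operatorname{Dom}\beta$. A map $\alpha\in\mathcal{P}_n$ is a contraction if $|x\alpha-y\alpha|\le|x-y|$ for all $x,y\in\operatorname{Dom}\alpha$; it is order preserving (resp. order reversing) if for all $x,y\in\operatorname{Dom}\alpha$, $x\le y$ implies $x\alpha\le y\alpha$ (resp. $x\alpha\ge y\alpha$). $\mathcal{CP}_n$ is the semigroup of all contractions in $\mathcal{P}_n$; $\mathcal{OCP}_n$ is the subsemigroup of order preserving contractions; $\mathcal{ORCP}_n$ is the subsemigroup of contractions that are order preserving or order reversing. For a semigroup $S$ (with $S^1$ denoting $S$ with an identity adjoined if necessary), $a\,\mathcal{R}^*\,b$ iff for all $x,y\in S^1$, $xa=ya\Leftrightarrow xb=yb$. The semigroup $S$ is called right abundant if every $\mathcal{R}^*$-class of $S$ contains an idempotent. *)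

(* Defs.v *)
From HB Require Import structures.
From mathcomp Require Import all_boot ssrint.

Set Implicit Arguments.
Unset Strict Implicit.
Unset Printing Implicit Defensive.

Import Algebra.
Local Open Scope group_scope.

Section RightAbundance.
Variable S : semigroupType.
Implicit Types (a b e : S) (x y : option S).

Definition is_identity e := left_id e *%g /\ right_id e *%g.

(* The elements of S^1: Some s stands for s in S, and None for the adjoined
   identity, which is present only when S has no identity of its own. *)
Definition in_S1 x :=
  if x is Some _ then True else ~ exists e, is_identity e.

Definition S1_mul x a := if x is Some s then s * a else a.

Definition Rstar a b :=
  forall x y, in_S1 x -> in_S1 y ->
    (S1_mul x a = S1_mul y a <-> S1_mul x b = S1_mul y b).

Definition idempotent_elt e := e * e = e.

Definition right_abundant :=
  forall a, exists e, Rstar a e /\ idempotent_elt e.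

End RightAbundance.

(* Partial maps of [n], with {1, ..., n} encoded as 'I_n = {0, ..., n - 1}:
   only the order and differences matter, so the shift by one is harmless.
   a x = None means that x is not in Dom a. *)
Definition ptransf (n : nat) := {ffun 'I_n -> option 'I_n}.

HB.instance Definition _ n := Choice.on (ptransf n).

(* Maps act on the right: x (a b) = (x a) b. *)
Definition ptransf_mul n (a b : ptransf n) : ptransf n :=
  [ffun x => obind b (a x)].

Lemma ptransf_mulA n : associative (@ptransf_mul n).
Proof.
move=> a b c; apply/ffunP => x; rewrite !ffunE.
by case: (a x) => //= u; rewrite ffunE.
Qed.

HB.instance Definition _ n := isSemigroup.Build (ptransf n) (@ptransf_mulA n).

Section Predicates.
Variable n : nat.
Implicit Types a b : ptransf n.

(* P x y (x a) (y a) holds for all x, y in Dom a. *)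
Definition forall_dom2 (P : 'I_n -> 'I_n -> 'I_n -> 'I_n -> bool) a : bool :=
  [forall x, forall y,
     if a x is Some u then if a y is Some v then P x y u v else true else true].

Definition contraction : pred (ptransf n) :=
  forall_dom2 (fun x y u v => (`|u - v| <= `|x - y|)%N).

Definition order_preserving : pred (ptransf n) :=
  forall_dom2 (fun x y u v => (x <= y)%N ==> (u <= v)%N).

Definition order_reversing : pred (ptransf n) :=
  forall_dom2 (fun x y u v => (x <= y)%N ==> (v <= u)%N).

Definition oc_pred : pred (ptransf n) :=
  [pred a | contraction a && order_preserving a].

Definition orc_pred : pred (ptransf n) :=
  [pred a | contraction a && (order_preserving a || order_reversing a)].

Lemma forall_dom2P (P : 'I_n -> 'I_n -> 'I_n -> 'I_n -> bool) a :
  reflect (forall x y u v, a x = Some u -> a y = Some v -> P x y u v)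
          (forall_dom2 P a).
Proof.
apply: (iffP forallP) => [h x y u v ax ay | h x].
  by move: (h x) => /forallP/(_ y); rewrite ax ay.
apply/forallP => y; case ax: (a x) => [u|] //; case ay: (a y) => [v|] //.
exact: h ax ay.
Qed.

Lemma ptransf_mulE a b x w :
  (a * b) x = Some w -> exists2 u, a x = Some u & b u = Some w.
Proof. by rewrite ffunE; case: (a x) => //= u; exists u. Qed.

Lemma contractionM a b : contraction a -> contraction b -> contraction (a * b).
Proof.
move=> /forall_dom2P ca /forall_dom2P cb; apply/forall_dom2P => x y u v.
move=> /ptransf_mulE[x' ax bx] /ptransf_mulE[y' ay by_].
exact: leq_trans (cb _ _ _ _ bx by_) (ca _ _ _ _ ax ay).
Qed.

Lemma opM a b :
  order_preserving a -> order_preserving b -> order_preserving (a * b).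
Proof.
move=> /forall_dom2P ha /forall_dom2P hb; apply/forall_dom2P => x y u v.
move=> /ptransf_mulE[x' ax bx] /ptransf_mulE[y' ay by_]; apply/implyP => xy.
exact: implyP (hb _ _ _ _ bx by_) (implyP (ha _ _ _ _ ax ay) xy).
Qed.

Lemma op_orM a b :
  order_preserving a -> order_reversing b -> order_reversing (a * b).
Proof.
move=> /forall_dom2P ha /forall_dom2P hb; apply/forall_dom2P => x y u v.
move=> /ptransf_mulE[x' ax bx] /ptransf_mulE[y' ay by_]; apply/implyP => xy.
exact: implyP (hb _ _ _ _ bx by_) (implyP (ha _ _ _ _ ax ay) xy).
Qed.

Lemma or_opM a b :
  order_reversing a -> order_preserving b -> order_reversing (a * b).
Proof.
move=> /forall_dom2P ha /forall_dom2P hb; apply/forall_dom2P => x y u v.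
move=> /ptransf_mulE[x' ax bx] /ptransf_mulE[y' ay by_]; apply/implyP => xy.
exact: implyP (hb _ _ _ _ by_ bx) (implyP (ha _ _ _ _ ax ay) xy).
Qed.

Lemma orM a b :
  order_reversing a -> order_reversing b -> order_preserving (a * b).
Proof.
move=> /forall_dom2P ha /forall_dom2P hb; apply/forall_dom2P => x y u v.
move=> /ptransf_mulE[x' ax bx] /ptransf_mulE[y' ay by_]; apply/implyP => xy.
exact: implyP (hb _ _ _ _ by_ bx) (implyP (ha _ _ _ _ ax ay) xy).
Qed.

Lemma contraction_mulg_closed : mulg_closed contraction.
Proof. by move=> a b; apply: contractionM. Qed.

Lemma oc_mulg_closed : mulg_closed oc_pred.
Proof.
move=> a b /andP[ca oa] /andP[cb ob]; apply/andP; split.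
  exact: contractionM.
exact: opM.
Qed.

Lemma orc_mulg_closed : mulg_closed orc_pred.
Proof.
move=> a b /andP[ca oa] /andP[cb ob]; apply/andP; split.
  exact: contractionM.
case/orP: oa => oa; case/orP: ob => ob; apply/orP.
- by left; apply: opM.
- by right; apply: op_orM.
- by right; apply: or_opM.
- by left; apply: orM.
Qed.

End Predicates.

Definition CP n := {a : ptransf n | contraction a}.
Definition OCP n := {a : ptransf n | oc_pred a}.
Definition ORCP n := {a : ptransf n | orc_pred a}.

HB.instance Definition _ n := SubChoice.on (CP n).
HB.instance Definition _ n := SubChoice_isSubSemigroup.Build
  (ptransf n) (@contraction n) (CP n) (@contraction_mulg_closed n).

HB.instance Definition _ n := SubChoice.on (OCP n).
HB.instance Definition _ n := SubChoice_isSubSemigroup.Build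
  (ptransf n) (@oc_pred n) (OCP n) (@oc_mulg_closed n).

HB.instance Definition _ n := SubChoice.on (ORCP n).
HB.instance Definition _ n := SubChoice_isSubSemigroup.Build
  (ptransf n) (@orc_pred n) (ORCP n) (@orc_mulg_closed n).

(* Main.v *)
(** Left multiplication by rank-one maps shows that R*-related elements have the
    same kernel (and domain), so an idempotent R*-related to a sends every point
    to a point of its own kernel class.  The map 1, 2, 3, 4, 5, ... |->
    1, 2, 2, 3, 4, ... has kernel classes {1}, {2, 3}, {4}, ...: such an
    idempotent fixes 1 and 4 and collapses 2 and 3 to one of them, so it
    stretches either [3, 4] or [1, 2] and is not a contraction. *)
Require Import Defs.
From mathcomp Require Import all_boot zify.

Set Implicit Arguments.
Unset Strict Implicit.
Unset Printing Implicit Defensive.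

Import Algebra.
Local Open Scope group_scope.

(** Allowing [o = None] adds the empty map, so that domains are compared together with kernels. *)
Definition point_map n (i : 'I_n) (o : option 'I_n) : ptransf n :=
  [ffun x => if x == i then o else None].

Lemma point_map_oc n (i : 'I_n) o : oc_pred (point_map i o).
Proof.
apply/andP; split; apply/forall_dom2P => x y u v; rewrite !ffunE;
  case: eqP => // _ ->; case: eqP => // _ [->]; lia.
Qed.

Lemma point_map_mul n (i : 'I_n) o (a : ptransf n) :
  point_map i o * a = point_map i (obind a o).
Proof. by apply/ffunP => x; rewrite !ffunE; case: eqP. Qed.

Lemma point_map_inj n (i : 'I_n) : injective (point_map i).
Proof. by move=> o o' /ffunP/(_ i); rewrite !ffunE eqxx. Qed.

(** With points counted from 0, the collapsed pair is 1 and 2. *)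
Definition collapse23 n : ptransf n :=
  [ffun x : 'I_n => Some (Ordinal (leq_ltn_trans (leq_subr (1 < x) x) (ltn_ord x)))].

Lemma collapse23_oc n : oc_pred (collapse23 n).
Proof.
apply/andP; split; apply/forall_dom2P => x y u v;
  rewrite !ffunE => -[<-] [<-] /=; lia.
Qed.

Section Embedding.
Variables (n : nat) (S : semigroupType) (f : S -> ptransf n).
Hypothesis f_inj : injective f.
Hypothesis fM : {morph f : s t / s * t}.
Hypothesis f_oc : forall a, oc_pred a -> exists s, f s = a.

(** Left multiplication by [point_map i o] evaluates a map at [o], and [f_oc] places these maps in
    [S]. *)
Lemma Rstar_ker (i : 'I_n) s t : Rstar s t ->
  forall o o', obind (f s) o = obind (f s) o' <-> obind (f t) o = obind (f t) o'.
Proof.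
move=> st o o'.
have [p fp] := f_oc (point_map_oc i o); have [q fq] := f_oc (point_map_oc i o').
have mulE r : p * r = q * r <-> obind (f r) o = obind (f r) o'.
  split=> [/(congr1 f)|eq_r]; last apply: f_inj; rewrite !fM fp fq !point_map_mul.
    exact: point_map_inj.
  by rewrite eq_r.
rewrite -!mulE; exact: (st (Some p) (Some q)).
Qed.

(** Covers the three semigroups at once: each consists of contractions and contains every order
    preserving one. *)
Lemma not_right_abundant :
  (forall s, contraction (f s)) -> 4 <= n -> ~ right_abundant S.
Proof.
move=> f_contr n4 abundant.
have [a fa] := f_oc (collapse23_oc n).
have [e [ae ee]] := abundant a.
pose pt k (k4 : k < 4) : 'I_n := Ordinal (leq_trans k4 n4).
have ker := Rstar_ker (pt 0 isT) ae; rewrite fa in ker.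
have e_class x : exists2 y, f e x = Some y & y - (1 < y) = x - (1 < x) :> nat.
  case ex: (f e x) => [y|]; last first.
    (* Comparison with [None]: [e] is total because [a] is. *)
    by have /ker := ex : obind (f e) (Some x) = obind (f e) None; rewrite /= ffunE.
  exists y => //.
  (* Idempotence puts [x] and its image [y] in one kernel class of [e], hence of [a]. *)
  have eyx : obind (f e) (Some y) = obind (f e) (Some x).
    by have /ffunP/(_ x) := fM e e; rewrite ee ffunE /= ex => ->.
  by have /ker := eyx; rewrite /= !ffunE => -[].
have [y0 e0 /= c0] := e_class (pt 0 isT).
have [y1 e1 /= c1] := e_class (pt 1%N isT).
have [y2 e2 /= c2] := e_class (pt 2 isT).
have [y3 e3 /= c3] := e_class (pt 3 isT).
have : y1 = y2.
  have : obind (f e) (Some (pt 1%N isT)) = obind (f e) (Some (pt 2 isT)).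
    by apply/ker; rewrite /= !ffunE; congr Some; apply: val_inj.
  by rewrite /= e1 e2 => -[].
have /forall_dom2P dist := f_contr e.
have := dist _ _ _ _ e0 e1; have := dist _ _ _ _ e2 e3 => /= d23 d01 y12.
(* Here [y0] is 0, [y3] is 3 and the common value [y2] is 1 or 2. *)
by move: d23 d01; rewrite y12 in c1 *; lia.
Qed.

End Embedding.

Theorem lemma2p6 (n : nat) (hn : 4 <= n) :
  ~ right_abundant (CP n) /\
  ~ right_abundant (ORCP n) /\
  ~ right_abundant (OCP n).
Proof.
split; last split.
- apply: (not_right_abundant (f := val)) hn => //; first exact: val_inj.
    by move=> a /andP[ca _]; exists (Sub a ca); rewrite SubK.
  exact: valP.
- apply: (not_right_abundant (f := val)) hn => //; first exact: val_inj.
    move=> a /andP[ca oa]; have oca : orc_pred a by rewrite /orc_pred /= ca oa.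
    by exists (Sub a oca); rewrite SubK.
  by move=> s; case/andP: (valP s).
- apply: (not_right_abundant (f := val)) hn => //; first exact: val_inj.
    by move=> a oca; exists (Sub a oca); rewrite SubK.
  by move=> s; case/andP: (valP s).
Qed.
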